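(* Let $p\in\{1,\dots,n\}$. If $f\colon\mathbb{B}^n\to\mathbb{R}$ is $p$-locally monotone, then $\wedge_jf$ and $\vee_jf$ are $(p-1)$-locally monotone for all $j\in[n]$.
   Context: $\mathbb{B}=\{0,1\}$, $[n]=\{1,\dots,n\}$. For $k\in[n]$, $\mathbf{x}\in\mathbb{B}^n$, $a\in\mathbb{B}$, $\mathbf{x}_k^a$ is the tuple obtained from $\mathbf{x}$ by replacing its $k$-th component by $a$; $\Delta_kf(\mathbf{x})=f(\mathbf{x}_k^1)-f(\mathbf{x}_k^0)$. For an integer $q\geq 0$, a function $h\colon\mathbb{B}^n\to\mathbb{R}$ is $q$-locally monotone if for every $k\in[n]$ and all $\mathbf{x},\mathbf{y}\in\mathbb{B}^n$ with $\sum_{i\in[n]\setminus\{k\}}|x_i-y_i|<q$ we have $\Delta_kh(\mathbf{x})\,\Delta_kh(\mathbf{y})\geq 0$ (for $q=0$ this condition is vacuous). The lattice derivatives are $\wedge_jf,\vee_jf\colon\mathbb{B}^n\to\mathbb{R}$, $\wedge_jf(\mathbf{x})=\min(f(\mathbf{x}_j^0),f(\mathbf{x}_j^1))$, $\vee_jf(\mathbf{x})=\max(f(\mathbf{x}_j^0),f(\mathbf{x}_j^1))$. *)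

(* Defs.v *)
From mathcomp Require Import all_boot all_order all_algebra.
From mathcomp Require Import reals.

Set Implicit Arguments.
Unset Strict Implicit.
Unset Printing Implicit Defensive.

Import Order.TTheory GRing.Theory Num.Theory.

Local Open Scope ring_scope.

(* The cube B^n; coordinates are indexed by 'I_n = {0, ..., n - 1} instead of
   {1, ..., n}. *)
Definition cube (n : nat) := {ffun 'I_n -> bool}.

Definition subst_coord (n : nat) (x : cube n) (k : 'I_n) (a : bool) : cube n :=
  [ffun i => if i == k then a else x i].

Section PseudoBoolean.

Variables (R : realType) (n : nat).

Definition pderiv (f : cube n -> R) (k : 'I_n) (x : cube n) : R :=
  f (subst_coord x k true) - f (subst_coord x k false).

(* The sum is a natural number: booleans coerce to 0 and 1, and `|u - v|%N is
   the distance between u and v (the subtraction takes place in int). *)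
Definition locally_monotone (q : nat) (h : cube n -> R) : Prop :=
  forall (k : 'I_n) (x y : cube n),
    (\sum_(i < n | i != k) `|x i - y i| < q)%N ->
    0 <= pderiv h k x * pderiv h k y.

Definition lattice_meet_deriv (j : 'I_n) (f : cube n -> R) (x : cube n) : R :=
  Num.min (f (subst_coord x j false)) (f (subst_coord x j true)).

Definition lattice_join_deriv (j : 'I_n) (f : cube n -> R) (x : cube n) : R :=
  Num.max (f (subst_coord x j false)) (f (subst_coord x j true)).

End PseudoBoolean.

(* Main.v *)
(** Let [j <> k]. If [x] and [y] are at distance less than [p - 1] off [k], the
    four points obtained from [x] and [y] by fixing the [j]-th coordinate are
    pairwise at distance less than [p] off [k], so the partial derivatives of [f]
    along [k] at these points all have the same weak sign. Since [min] and [max]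
    are nondecreasing in both arguments, the derivatives along [k] of the lattice
    derivatives at [x] and [y] inherit that common sign. If [j = k] they vanish. *)

Require Import Defs.
From mathcomp Require Import all_boot all_order all_algebra.
From mathcomp Require Import reals.

Set Implicit Arguments.
Unset Strict Implicit.
Unset Printing Implicit Defensive.

Import Order.TTheory GRing.Theory Num.Theory.

Lemma subst_coordC n (x : cube n) (j k : 'I_n) (a b : bool) : j != k ->
  subst_coord (subst_coord x j a) k b = subst_coord (subst_coord x k b) j a.
Proof.
move=> neq_jk; apply/ffunP => i; rewrite !ffunE.
by case: (eqVneq i k) => [->|//]; rewrite eq_sym (negbTE neq_jk).
Qed.

Lemma subst_coordK n (x : cube n) (k : 'I_n) (a b : bool) :
  subst_coord (subst_coord x k a) k b = subst_coord x k b.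
Proof. by apply/ffunP => i; rewrite !ffunE; case: eqP. Qed.

(** Only the summand at [j] can change, and it is at most 1 for booleans. *)
Lemma leq_dist_subst_coord n (P : pred 'I_n) (x y : cube n) (j : 'I_n)
    (a b : bool) :
  (\sum_(i < n | P i) `|subst_coord x j a i - subst_coord y j b i|
     <= (\sum_(i < n | P i) `|x i - y i|).+1)%N.
Proof.
have le1 : (\sum_(i < n | P i) (i == j) <= 1)%N.
  rewrite big_mkcond (bigD1 j) //= big1 ?addn0 => [|i /negbTE ->].
    by case: ifP => // _; rewrite eqxx.
  by case: ifP.
(* Spreading the extra 1 as the indicator of [j] allows a termwise comparison. *)
rewrite -addn1; apply: leq_trans (leq_add (leqnn _) le1).
rewrite -big_split /=; apply: leq_sum => i _; rewrite !ffunE.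
by case: eqP => // _; case: a b (x i) (y i) => [] [] [] [].
Qed.

Local Open Scope ring_scope.

(** A single strictly positive value forces all the others to be nonnegative; without one, all are
    at most 0. *)
Lemma pairwise_mulr_ge0_same_sign (R : realDomainType) (I : finType)
    (d : I -> R) :
  (forall u v, 0 <= d u * d v) -> (forall u, 0 <= d u) \/ (forall u, d u <= 0).
Proof.
move=> d_ge0; have [/existsP[u du]|/existsPn dN] := boolP [exists u, 0 < d u].
  by left=> v; rewrite -(pmulr_rge0 _ du).
by right=> v; rewrite leNgt.
Qed.

Lemma locally_monotone_comb (R : realType) (n p : nat) (f : cube n -> R)
    (j : 'I_n) (op : R -> R -> R) :
  (forall a b c d, a <= b -> c <= d -> op a c <= op b d) ->
  locally_monotone p f ->
  locally_monotone (p - 1)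
    (fun x => op (f (subst_coord x j false)) (f (subst_coord x j true))).
Proof.
move=> op_le f_mono k x y dist_xy; rewrite /pderiv.
have [<-|neq_jk] := eqVneq j k; first by rewrite !subst_coordK subrr mul0r.
have neq_kj : k != j by rewrite eq_sym.
pose z (b : bool) := if b then x else y.
pose d (u : bool * bool) := pderiv f k (subst_coord (z u.1) j u.2).
have d_ge0 u v : 0 <= d u * d v.
  apply: f_mono; apply: leq_ltn_trans (leq_dist_subst_coord _ _ _ _ _ _) _.
  apply: (@leq_ltn_trans (\sum_(i < n | i != k) `|x i - y i|).+1); last first.
    (* The gap between [p - 1] and [p] pays for the one unit that fixing coordinate [j] may add. *)
    by rewrite ltn_subRL add1n in dist_xy.
  (* Each term is 0 if both base points coincide, and symmetric in [x] and [y] otherwise. *)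
  rewrite ltnS; apply: leq_sum => i _; rewrite /z.
  by case: u.1 v.1 => [] []; case: (x i) (y i) => [] [].
(* With [k] substituted last, matching arguments of [op] differ by values of [d]. *)
rewrite !(subst_coordC _ _ _ neq_kj).
have [d_pos|d_neg] := pairwise_mulr_ge0_same_sign d_ge0.
  have le_f b a : f (subst_coord (subst_coord (z b) j a) k false)
      <= f (subst_coord (subst_coord (z b) j a) k true).
    by rewrite -subr_ge0; apply: (d_pos (b, a)).
  by apply: mulr_ge0; rewrite subr_ge0; apply: op_le;
    do [exact: (le_f true) | exact: (le_f false)].
have le_f b a : f (subst_coord (subst_coord (z b) j a) k true)
    <= f (subst_coord (subst_coord (z b) j a) k false).
  by rewrite -subr_le0; apply: (d_neg (b, a)).
by apply: mulr_le0; rewrite subr_le0; apply: op_le;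
  do [exact: (le_f true) | exact: (le_f false)].
Qed.

Theorem theorem19 (R : realType) (n p : nat) (f : cube n -> R) :
  (1 <= p <= n)%N ->
  locally_monotone p f ->
  forall j : 'I_n,
    locally_monotone (p - 1) (lattice_meet_deriv j f) /\
    locally_monotone (p - 1) (lattice_join_deriv j f).
Proof.
move=> _ f_mono j; split.
  apply: (@locally_monotone_comb R n p f j Num.min) f_mono => a b c d le_ab le_cd.
  by rewrite le_min !ge_min le_ab le_cd orbT.
apply: (@locally_monotone_comb R n p f j Num.max) f_mono => a b c d le_ab le_cd.
by rewrite ge_max !le_max le_ab le_cd orbT.
Qed.
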